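(* Let $\mathscr S$ be an operator system, let $\mathscr T$ be a unital $C^*$-algebra, let $\mathcal K\subseteq \mathrm{CP}(\mathscr S,\mathscr T)$, and let $\Phi_0\in \mathrm{CP}(\mathscr S,\mathscr T)$. Then the following are equivalent: (i) $\Phi_0\in\overline{\mathrm{cconv}(\mathcal K)}^{\,\tau}$. (ii) For every matrix test $(k,f,s)$, $$\Re\, f\big((\Phi_0)_k(s)\big)\le h_{\mathcal K}(k,f,s)=\sup_{\Psi\in \mathrm{cconv}(\mathcal K)}\Re\, f\big(\Psi_k(s)\big).$$
   Context: Unital $C^*$-algebras are assumed nonzero ($\mathbb 1\neq 0$). $\mathrm{CP}(\mathscr S,\mathscr T)$ is the set of all completely positive linear maps $\mathscr S\to\mathscr T$. For a linear map $\Phi:\mathscr S\to\mathscr T$ and $k\in\mathbb N$ ($k\ge1$), $\Phi_k:M_k(\mathscr S)\to M_k(\mathscr T)$ is the ampliation $\Phi_k([s_{ij}])=[\Phi(s_{ij})]$. A $C^*$-convex combination of $\Phi_1,\dots,\Phi_n\in \mathrm{CP}(\mathscr S,\mathscr T)$ is a map $\sum_{i=1}^n a_i^*\Phi_i(\cdot)a_i$ with $a_i\in\mathscr T$ and $\sum_{i=1}^n a_i^*a_i=\mathbb 1_{\mathscr T}$ ($n\ge 1$). A subset of $\mathrm{CP}(\mathscr S,\mathscr T)$ is $C^*$-convex if it is closed under all such finite combinations of its elements; $\mathrm{cconv}(\mathcal K)$ is the smallest $C^*$-convex subset of $\mathrm{CP}(\mathscr S,\mathscr T)$ containing $\mathcal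 K$ (so $\mathrm{cconv}(\varnothing)=\varnothing$). A matrix test is a triple $(k,f,s)$ with $k\in\mathbb N$, $f$ a state on $M_k(\mathscr T)$ (positive linear functional with $f(\mathbb 1)=1$), and $s\in M_k(\mathscr S)$. $\mathcal E=\mathrm{span}_{\mathbb C}(\mathrm{CP}(\mathscr S,\mathscr T))$, a complex vector space of linear maps $\mathscr S\to\mathscr T$. $\tau$ is the locally convex topology on $\mathcal E$ generated by the seminorms $p_{k,f,s}(\Phi)=|f(\Phi_k(s))|$ over all matrix tests $(k,f,s)$, and $\overline{\,\cdot\,}^{\,\tau}$ is $\tau$-closure in $\mathcal E$. The support function is $h_{\mathcal K}(k,f,s)=\sup_{\Psi\in\mathrm{cconv}(\mathcal K)}\Re f(\Psi_k(s))\in[-\infty,\infty]$, with $\sup\varnothing=-\infty$. *)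

(* Defs.v *)
From HB Require Import structures.
From mathcomp Require Import all_boot all_order all_algebra.
From mathcomp Require Import complex.
From mathcomp Require Import boolp classical_sets functions reals ereal.
From mathcomp Require Import topology.
Set Implicit Arguments.
Unset Strict Implicit.
Unset Printing Implicit Defensive.
Import Order.TTheory GRing.Theory Num.Theory.

Local Open Scope classical_set_scope.
Local Open Scope complex_scope.
Local Open Scope ring_scope.

(* An algType is nonzero, so 1 != 0.  The norm is part of the mixin because no
   structure can inherit from both the ring and the normed module hierarchies
   of the library: numDomainType is already their only common descendant. *)
HB.mixin Record isCStarAlgebra (R : realType) A of GRing.Algebra R[i] A := {
  star : A -> A;
  cnorm : A -> R;
  starK : involutive star;
  starD : forall x y, star (x + y) = star x + star y;
  starZ : forall (c : R[i]) x, star (c *: x) = c^* *: star x;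
  starM : forall x y, star (x * y) = star y * star x;
  cnormD : forall x y, cnorm (x + y) <= cnorm x + cnorm y;
  cnormZ : forall (c : R[i]) x,
    cnorm (c *: x) = Normc.normc c * cnorm x;
  cnorm0_eq0 : forall x, cnorm x = 0 -> x = 0;
  cnormM : forall x y, cnorm (x * y) <= cnorm x * cnorm y;
  cnorm_starM : forall x, cnorm (star x * x) = cnorm x ^+ 2;
  cnorm_complete : forall u : nat -> A,
    (forall e : R, 0 < e -> exists N : nat, forall m n,
       (N <= m)%N -> (N <= n)%N -> cnorm (u m - u n) < e) ->
    exists l : A, forall e : R, 0 < e -> exists N : nat, forall n,
      (N <= n)%N -> cnorm (u n - l) < e }.

#[short(type="cstarAlgType")]
HB.structure Definition CStarAlgebra (R : realType) :=
  {A of isCStarAlgebra R A & GRing.Algebra R[i] A}.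

Section MatrixPositivity.
Context {R : realType} {T : cstarAlgType R}.

Definition star_mx m n (X : 'M[T]_(m, n)) : 'M[T]_(n, m) :=
  map_mx star X^T.

Definition pos_mx k (X : 'M[T]_k) : Prop :=
  exists Y : 'M[T]_k, X = star_mx Y *m Y.

(* The library makes 'M[T]_k a module over T but not over R[i]; scalars act
   entrywise through map_mx. *)
Record state k := State {
  state_fun :> 'M[T]_k -> R[i];
  stateD : forall X Y, state_fun (X + Y) = state_fun X + state_fun Y;
  stateZ : forall (c : R[i]) X,
    state_fun (map_mx ( *:%R c) X) = c * state_fun X;
  state_ge0 : forall X, pos_mx X -> 0 <= state_fun X;
  state1 : state_fun 1%:M = 1 }.

End MatrixPositivity.

Arguments state {R} T k.

(* A unital self-adjoint linear subspace of a unital C*-algebra, not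
   necessarily closed. *)
Record operatorSystem (R : realType) (A : cstarAlgType R) := OperatorSystem {
  opsys_set :> {pred A};
  opsys1 : 1 \in opsys_set;
  opsys_linear : linear_closed opsys_set;
  opsys_star : {in opsys_set, forall x, star x \in opsys_set} }.

Section OperatorSystemType.
Context {R : realType} {A : cstarAlgType R}.

Lemma opsys_submod_closed (S : operatorSystem A) :
  submod_closed (opsys_set S).
Proof.
split; last exact: opsys_linear.
have := opsys_linear (-1) (opsys1 S) (opsys1 S).
by rewrite scaleN1r addNr.
Qed.

HB.instance Definition _ (S : operatorSystem A) :=
  GRing.isSubmodClosed.Build R[i] A (opsys_set S) (opsys_submod_closed S).

Record opsys (S : operatorSystem A) :=
  Opsys { opsys_val : A; opsys_valP : opsys_val \in opsys_set S }.

HB.instance Definition _ (S : operatorSystem A) :=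
  [isSub for @opsys_val S].
HB.instance Definition _ (S : operatorSystem A) :=
  [Choice of opsys S by <:].
HB.instance Definition _ (S : operatorSystem A) :=
  [SubChoice_isSubLmodule of opsys S by <:].

Definition opsys_pos_mx (S : operatorSystem A) k (X : 'M[opsys S]_k) : Prop :=
  pos_mx (map_mx val X).

End OperatorSystemType.

Section CPMaps.
Context {R : realType} {A : cstarAlgType R}.
Variables (S : operatorSystem A) (T : cstarAlgType R).

(* The ampliation of Phi to 'M_k is map_mx Phi. *)
Definition CP : set (opsys S -> T) :=
  [set Phi | linear Phi /\
    forall k (X : 'M[opsys S]_k), (0 < k)%N ->
      opsys_pos_mx X -> pos_mx (map_mx Phi X)].

Definition cstar_convex (M : set (opsys S -> T)) : Prop :=
  forall n (a : 'I_n -> T) (Phi : 'I_n -> opsys S -> T),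
    (0 < n)%N -> (forall i, M (Phi i)) ->
    \sum_(i < n) star (a i) * a i = 1 ->
    M (fun x => \sum_(i < n) star (a i) * Phi i x * a i).

(* CP is itself C*-convex, so for K `<=` CP this is also the smallest
   C*-convex subset of CP containing K. *)
Definition cconv (K : set (opsys S -> T)) : set (opsys S -> T) :=
  smallest cstar_convex K.

Definition cspan (V : lmodType R[i]) (P : set V) : set V :=
  [set v | exists n (c : 'I_n -> R[i]) (w : 'I_n -> V),
    (forall i, P (w i)) /\ v = \sum_(i < n) c i *: w i].

Definition spanCP : {pred opsys S -> T} := [pred Phi | `[< cspan CP Phi >]].

Lemma spanCP_submod_closed : submod_closed spanCP.
Proof.
split.
  apply/asboolP; exists 0%N; exists (fun=> 0); exists (fun=> 0).
  by split=> [[]//|]; rewrite big_ord0.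
move=> a Phi Psi /asboolP[n [c [w [wP ->]]]] /asboolP[m [d [u [uP ->]]]].
apply/asboolP; exists (n + m)%N.
exists (fun i : 'I_(n + m) => match fintype.split i with inl j => a * c j | inr j => d j end).
exists (fun i : 'I_(n + m) => match fintype.split i with inl j => w j | inr j => u j end).
split=> [i|]; first by case: fintype.split.
rewrite big_split_ord scaler_sumr /=; congr (_ + _); apply: eq_bigr => i _.
  by rewrite (unsplitK (inl i)) scalerA.
by rewrite (unsplitK (inr i)).
Qed.

HB.instance Definition _ :=
  GRing.isSubmodClosed.Build R[i] (opsys S -> T) spanCP spanCP_submod_closed.

Record Espace := EMap { Efun :> opsys S -> T; EfunP : Efun \in spanCP }.

HB.instance Definition _ := [isSub for Efun].
HB.instance Definition _ := [Choice of Espace by <:].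
HB.instance Definition _ := [SubChoice_isSubLmodule of Espace by <:].

Record matrixTest := MatrixTest {
  mt_size : nat;
  mt_size_gt0 : (0 < mt_size)%N;
  mt_state : state T mt_size;
  mt_mx : 'M[opsys S]_mt_size }.

Definition test_val (t : matrixTest) (Phi : opsys S -> T) : R[i] :=
  mt_state t (map_mx Phi (mt_mx t)).

Definition test_seminorm (t : matrixTest) (Phi : Espace) : R :=
  Normc.normc (test_val t Phi).

(* The topology generated by the seminorms has the open semiballs as a
   subbase. *)
Definition semiballs : set (set Espace) :=
  [set U | exists (t : matrixTest) (Phi : Espace) (e : R),
    0 < e /\ U = [set Psi | test_seminorm t (Psi - Phi) < e]].

HB.instance Definition _ := isSubBaseTopological.Build Espace semiballs id.

Definition support_fun (K : set (opsys S -> T)) (t : matrixTest) : \bar R :=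
  ereal_sup [set (complex.Re (test_val t Psi))%:E | Psi in cconv K].

Lemma CP_spanCP (Phi : opsys S -> T) : CP Phi -> Phi \in spanCP.
Proof.
move=> CPPhi; apply/asboolP.
exists 1%N; exists (fun=> 1); exists (fun=> Phi); split=> //.
by rewrite big_ord_recl big_ord0 addr0 scale1r.
Qed.

Definition CP_Espace (Phi : opsys S -> T) (CPPhi : CP Phi) : Espace :=
  EMap (CP_spanCP CPPhi).

End CPMaps.

Arguments CP {R A} S T _.

(* Main.v *)
(* If Phi0 is not in the closure, finitely many tests and some e > 0 separate
   it from cconv K.  The values of these tests map cconv K onto a convex subset
   of C^m, so Hahn-Banach gives coefficients c_j such that the real part of
   sum_j c_j f_j(Psi(s_j)) is smaller by e on cconv K than at Phi0.  Such a
   combination is again a matrix test: average the states over the diagonal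
   blocks of a larger matrix algebra and rescale the s_j.  Support functions
   therefore already detect the separation.

   For K empty the support function is -oo, and one needs that T has a state.
   It is a norm-one extension of 1 |-> 1; its positivity requires y* y to be
   positive.  This is shown by a power argument instead of the functional
   calculus: with s = 1 - y* y and z = y s^n, positivity of z* z + z z* and an
   upper bound for z z* give s^(2n+1) <= 1 + s^(2n) for every n, which forces
   the norm of s to be at most 1. *)
Require Import Defs.
From HB Require Import structures.
From mathcomp Require Import all_boot all_order all_algebra.
From mathcomp Require Import complex.
From mathcomp Require Import boolp classical_sets functions reals ereal.
From mathcomp Require Import topology.
From mathcomp Require Import lra.
Set Implicit Arguments.
Unset Strict Implicit.
Unset Printing Implicit Defensive.
Import Order.TTheory GRing.Theory Num.Theory.
Local Open Scope classical_set_scope.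
Local Open Scope complex_scope.
Local Open Scope ring_scope.

(** * Sublinear functionals *)

Section MazurOrlicz.
Context {R : realType} {V : lmodType R[i]}.
Implicit Types (q g : V -> R) (W : V -> R -> Prop).

(** Only real factors occur. Applying the second inequality to [r^-1] as well turns it into an
    equality for r > 0. *)
Definition sublinear q : Prop :=
  (forall x y, q (x + y) <= q x + q y) /\
  (forall r x, 0 < r -> q (r%:C *: x) <= r * q x).

Definition real_linear g : Prop :=
  (forall x y, g (x + y) = g x + g y) /\ (forall r x, g (r%:C *: x) = r * g x).

(** A cone in V x R, given as a relation: [W w a] reads as the constraint a <= g w on the functional
    g sought. *)
Definition convex_cone W : Prop :=
  [/\ W 0 0, forall v w a b, W v a -> W w b -> W (v + w) (a + b)
    & forall r w a, 0 < r -> W w a -> W (r%:C *: w) (r * a)].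

Lemma sublinear0 q : sublinear q -> q 0 = 0.
Proof.
move=> [_ qZ].
have := qZ 2 0; have := qZ 2^-1 0; rewrite !scaler0.
have h2 : (0 : R) < 2 by [].
have h2' : (0 : R) < 2^-1 by rewrite invr_gt0.
move=> /(_ h2') A1 /(_ h2) A2; lra.
Qed.

Lemma sublinear_geN q x : sublinear q -> - q (- x) <= q x.
Proof.
move=> sq; have := sq.1 x (- x); rewrite subrr sublinear0 //; lra.
Qed.

(** For a cone [W] with a <= q w on it, the linear functionals below this one are exactly the linear
    g <= q that satisfy a <= g w whenever [W w a]. *)
Definition infconv q W (x : V) : R :=
  inf [set r | exists w a, W w a /\ r = q (x + w) - a].

Section InfConv.
Variables (q : V -> R) (W : V -> R -> Prop).
Hypotheses (sq : sublinear q) (cW : convex_cone W)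
  (Wq : forall w a, W w a -> a <= q w).

Lemma infconv_le x w a : W w a -> infconv q W x <= q (x + w) - a.
Proof.
move=> Wwa; apply: ge_inf; last by exists w, a.
exists (- q (- x)) => _ [w' [a' [W' ->]]].
have := sq.1 (x + w') (- x); rewrite addrAC subrr add0r.
have := Wq W'; lra.
Qed.

Lemma le_infconv x r :
  (forall w a, W w a -> r <= q (x + w) - a) -> r <= infconv q W x.
Proof.
move=> h; apply: lb_le_inf; last by move=> _ [w [a [Wwa ->]]]; exact: h.
by case: cW => W0 _ _; exists (q (x + 0) - 0), 0, 0.
Qed.

Lemma infconv_le_id x : infconv q W x <= q x.
Proof. by case: cW => W0 _ _; have := infconv_le x W0; rewrite addr0 subr0. Qed.

Lemma infconv_opp w a : W w a -> infconv q W (- w) <= - a.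
Proof.
by move=> Wwa; have := infconv_le (- w) Wwa; rewrite addNr sublinear0 ?add0r.
Qed.

Lemma infconv_sublinear : sublinear (infconv q W).
Proof.
case: cW => W0 WD WZ; split=> [x y|r x r0].
  rewrite -lerBlDr; apply: le_infconv => v a Wv.
  rewrite lerBlDr -lerBlDl; apply: le_infconv => w b Ww.
  have := infconv_le (x + y) (WD _ _ _ _ Wv Ww).
  have := sq.1 (x + v) (y + w); rewrite addrACA; lra.
rewrite -ler_pdivrMl //; apply: le_infconv => w a Ww.
rewrite ler_pdivrMl //.
have := infconv_le (r%:C *: x) (WZ _ _ _ r0 Ww).
have := sq.2 r (x + w) r0; rewrite -scalerDr mulrBr; lra.
Qed.

End InfConv.

(** Inf-convolution of q with the ray of pairs (t y, t q y) is sublinear and below q, hence equal to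
    q by minimality. Its value at x is at most q(x + y) - q y, which reverses subadditivity. *)
Lemma minimal_sublinear_real_linear q : sublinear q ->
  (forall q', sublinear q' -> (forall x, q' x <= q x) ->
    forall x, q x <= q' x) ->
  real_linear q.
Proof.
move=> sq qmin; have q0 := sublinear0 sq.
have qZ r x : 0 < r -> q (r%:C *: x) = r * q x.
  move=> r0; apply/eqP; rewrite eq_le sq.2 //=.
  rewrite -ler_pdivlMl //.
  have := sq.2 r^-1 (r%:C *: x); rewrite invr_gt0 => /(_ r0).
  by rewrite scalerA -rmorphM mulVf ?gt_eqF // scale1r.
have qD x y : q (x + y) = q x + q y.
  apply/eqP; rewrite eq_le sq.1 /=.
  pose W w a := exists t, [/\ 0 <= t, w = t%:C *: y & a = t * q y].
  have cW : convex_cone W.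
    split=> [|v w a b [t [t0 -> ->]] [s [s0 -> ->]]|r w a r0 [t [t0 -> ->]]].
    - by exists 0; rewrite scale0r mul0r.
    - by exists (t + s); rewrite addr_ge0 // rmorphD scalerDl mulrDl.
    - exists (r * t); split; first exact: mulr_ge0 (ltW r0) t0.
        by rewrite rmorphM scalerA.
      by rewrite mulrA.
  have Wq w a : W w a -> a <= q w.
    move=> [t [t0 -> ->]]; case: (ltrgtP 0 t) t0 => // [t0|<-] _.
      by rewrite qZ.
    by rewrite mul0r scale0r q0.
  have Wy : W y (q y) by exists 1; rewrite scale1r mul1r.
  have := infconv_le sq Wq x Wy.
  have := qmin _ (infconv_sublinear sq cW Wq) (infconv_le_id sq cW Wq) x; lra.
have qN x : q (- x) = - q x.
  by have := qD x (- x); rewrite subrr q0; lra.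
split=> // r x; case: (ltrgtP 0 r) => [/qZ//|r0|<-]; last first.
  by rewrite scale0r mul0r.
rewrite -[r]opprK rmorphN scaleNr qN qZ ?oppr_gt0 //; lra.
Qed.

(** Zorn's lemma, ordered downwards: the pointwise infimum of a chain is finite because -q(-x)
    bounds it from below. *)
Lemma exists_minimal_sublinear q : sublinear q ->
  exists g, [/\ sublinear g, forall x, g x <= q x & forall q', sublinear q' ->
    (forall x, q' x <= g x) -> forall x, g x <= q' x].
Proof.
move=> sq.
pose D := {f : V -> R | sublinear f /\ forall x, f x <= q x}.
pose le (f f' : D) : bool := `[< forall x, sval f' x <= sval f x >].
pose q0 : D := exist _ q (conj sq (fun x => lexx (q x))).
have [] := @ZL_preorder D q0 le.
- by move=> f; apply/asboolP.
- move=> f g h /asboolP fg /asboolP gh; apply/asboolP => x.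
  exact: le_trans (gh x) (fg x).
- move=> B Btot.
  have [->|/set0P[f0 Bf0]] := eqVneq B set0; first by exists q0.
  pose m x := inf [set sval f x | f in B].
  have mle x f : B f -> m x <= sval f x.
    move=> Bf; apply: ge_inf; last by exists f.
    exists (- q (- x)) => _ [f' Bf' <-].
    have [sf' f'q] := svalP f'.
    by have := sublinear_geN x sf'; have := f'q (- x); lra.
  have lem x r : (forall f, B f -> r <= sval f x) -> r <= m x.
    move=> h; apply: lb_le_inf; first by exists (sval f0 x), f0.
    by move=> _ [f Bf <-]; exact: h.
  have sm : sublinear m.
    split=> [x y|r x r0].
      rewrite -lerBlDr; apply: (lem x) => f Bf.
      rewrite lerBlDr -lerBlDl; apply: (lem y) => f' Bf'.
      (* Subadditivity of the infimum uses the chain condition: the smaller of f and f' bounds [m]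
         at x + y. *)
      have [/asboolP h|/asboolP h] := Btot f f' Bf Bf'.
        by have := mle (x + y) f' Bf'; have := (svalP f').1.1 x y;
          have := h x; lra.
      by have := mle (x + y) f Bf; have := (svalP f).1.1 x y; have := h y; lra.
    rewrite -ler_pdivrMl //; apply: (lem x) => f Bf; rewrite ler_pdivrMl //.
    exact: le_trans (mle _ f Bf) ((svalP f).1.2 r x r0).
  have mq x : m x <= q x by exact: le_trans (mle x f0 Bf0) ((svalP f0).2 x).
  by exists (exist _ m (conj sm mq)) => f Bf; apply/asboolP => x; exact: mle.
move=> [g [sg gq]] gmin; exists g; split=> // q' sq' q'g.
have q'q x : q' x <= q x by exact: le_trans (q'g x) (gq x).
have := gmin (exist _ q' (conj sq' q'q)).
by move=> /(_ (asboolT q'g))/asboolP.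
Qed.

(** A minimal sublinear g below [infconv q W] is linear, and its bound g(-w) <= -a is the constraint
    at w. *)
Lemma mazur_orlicz q W : sublinear q -> convex_cone W ->
  (forall w a, W w a -> a <= q w) ->
  exists g, [/\ real_linear g, forall x, g x <= q x
    & forall w a, W w a -> a <= g w].
Proof.
move=> sq cW Wq.
have [g [sg gq gmin]] := exists_minimal_sublinear (infconv_sublinear sq cW Wq).
have lg := minimal_sublinear_real_linear sg gmin.
exists g; split=> // [x|w a Wwa].
  exact: le_trans (gq x) (infconv_le_id sq cW Wq x).
have := le_trans (gq (- w)) (infconv_opp sq Wq Wwa).
by rewrite -scaleN1r -(rmorphN1 (real_complex R)) lg.2 mulN1r lerN2.
Qed.

End MazurOrlicz.

(** * Square roots and positivity in a C*-algebra *)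

Section CStar.
Context {R : realType} {T : cstarAlgType R}.
Implicit Types (x y z a b w : T) (r t e : R).

Lemma normc_real r : 0 <= r -> Normc.normc r%:C = r.
Proof. by move=> r0; rewrite /= expr0n addr0 sqrtr_sqr ger0_norm. Qed.

Lemma cnormZr r x : 0 <= r -> cnorm (r%:C *: x) = r * cnorm x.
Proof. by move=> r0; rewrite cnormZ normc_real. Qed.

Lemma cnorm0 : cnorm (0 : T) = 0.
Proof.
by rewrite -(scale0r 0) -(rmorph0 (real_complex R)) cnormZr // mul0r.
Qed.

Lemma cnormN x : cnorm (- x) = cnorm x.
Proof. by rewrite -scaleN1r cnormZ normcN Normc.normc1 mul1r. Qed.

Lemma cnorm_ge0 x : 0 <= cnorm x.
Proof. by have := cnormD x (- x); rewrite subrr cnormN cnorm0; lra. Qed.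

Lemma cnorm_eq0P x : (forall e, 0 < e -> cnorm x <= e) -> x = 0.
Proof.
move=> h; apply: cnorm0_eq0; apply/eqP; rewrite eq_le cnorm_ge0 andbT.
by apply/ler_addgt0Pl => e /h; rewrite addr0.
Qed.

Lemma starZ_conjc (c : R[i]) x : star (c *: x) = (conjc c) *: star x.
Proof. exact: starZ. Qed.

Lemma star0 : star (0 : T) = 0.
Proof. by rewrite -[X in star X](scale0r 0) starZ_conjc conjc0 scale0r. Qed.

Lemma starN x : star (- x) = - star x.
Proof. by apply/eqP; rewrite -addr_eq0 -starD addNr star0. Qed.

Lemma star1 : star (1 : T) = 1.
Proof. by rewrite -[LHS]mulr1 -{2}(starK 1) -starM mulr1 starK. Qed.

Lemma starB x y : star (x - y) = star x - star y.
Proof. by rewrite starD starN. Qed.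

Lemma starZr r x : star (r%:C *: x) = r%:C *: star x.
Proof. by rewrite starZ_conjc conjc_real. Qed.

Lemma starX x n : star (x ^+ n) = star x ^+ n.
Proof.
by elim: n => [|n ih]; rewrite ?expr0 ?star1 // exprS starM ih exprSr.
Qed.

Lemma cnorm_star x : cnorm (star x) = cnorm x.
Proof.
have h y : cnorm y <= cnorm (star y).
  have := cnormM (star y) y; rewrite cnorm_starM expr2.
  have := cnorm_ge0 y; rewrite le_eqVlt => /predU1P[<- _|y0].
    exact: cnorm_ge0.
  by rewrite ler_pM2r.
by apply/eqP; rewrite eq_le h andbT; have := h (star x); rewrite starK.
Qed.

Lemma cnorm1 : cnorm (1 : T) = 1.
Proof.
have := cnorm_starM (1 : T); rewrite star1 mulr1 expr2 => /esym/eqP.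
rewrite -subr_eq0 -[X in _ - X]mulr1 -mulrBr mulf_eq0 subr_eq0.
by case/orP=> /eqP // /cnorm0_eq0/eqP; rewrite oner_eq0.
Qed.

Lemma cnorm_sqr x : star x = x -> cnorm (x * x) = cnorm x ^+ 2.
Proof. by move=> xs; rewrite -{1}xs cnorm_starM. Qed.

Lemma cnormX_le x n : cnorm (x ^+ n) <= cnorm x ^+ n.
Proof.
elim: n => [|n ih]; first by rewrite !expr0 cnorm1.
rewrite !exprS; apply: le_trans (cnormM _ _) _.
by rewrite ler_wpM2l ?cnorm_ge0.
Qed.

(** The C*-identity settles the exponents 2^n. In general x^(2^n) is the product of x^n and x^(2^n -
    n), so a strict inequality for x^n would contradict that case. *)
Lemma cnormX x n : star x = x -> cnorm (x ^+ n) = cnorm x ^+ n.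
Proof.
move=> xs; apply/eqP; rewrite eq_le cnormX_le /=.
have pow2 m : cnorm (x ^+ (2 ^ m)) = cnorm x ^+ (2 ^ m).
  elim: m => [|m ih]; first by rewrite !expr1.
  rewrite expnS mulnC !exprM expr2 cnorm_sqr ?ih //.
  by rewrite starX xs.
have /orP[/eqP x0|x0] : (0 == cnorm x) || (0 < cnorm x).
  by rewrite -le_eqVlt cnorm_ge0.
  case: n => [|n]; first by rewrite !expr0 cnorm1.
  by rewrite -x0 expr0n /= cnorm_ge0.
have n2 : (n <= 2 ^ n)%N by apply/ltnW/ltn_expl.
have := pow2 n; rewrite -(subnKC n2) !exprD => /esym h.
have := cnormM (x ^+ n) (x ^+ (2 ^ n - n)).
rewrite -h => h'.
have {}h' := le_trans h' (ler_wpM2l (cnorm_ge0 _) (cnormX_le _ _)).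
by rewrite ler_pM2r ?exprn_gt0 in h'.
Qed.

Lemma geometric_lt r e : 0 <= r < 1 -> 0 < e ->
  exists N : nat, forall n, (N <= n)%N -> r ^+ n < e.
Proof.
move=> /andP[]; rewrite le_eqVlt => /orP[/eqP<- _ e0|r0 r1 e0].
  by exists 1%N => -[|n] // _; rewrite expr0n.
have d0 : 0 < r^-1 - 1 by rewrite subr_gt0 invf_gt1.
pose N := Num.Def.archi_bound (e^-1 / (r^-1 - 1)).
exists N => n Nn.
have hN : e^-1 < (r^-1 - 1) * n%:R.
  rewrite -ltr_pdivrMl // mulrC.
  apply: lt_le_trans (archi_boundP _) _; last by rewrite ler_nat.
  by rewrite divr_ge0 ?invr_ge0 ?ltW.
(* Bernoulli's inequality for the powers of r^-1. *)
have bern m : 1 + (r^-1 - 1) * m%:R <= r^-1 ^+ m.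
  elim: m => [|m ih]; first by rewrite mulr0 addr0 expr0.
  rewrite exprS.
  have h1 : 1 + (r^-1 - 1) * m.+1%:R <= r^-1 * (1 + (r^-1 - 1) * m%:R).
    rewrite -natr1; set k : R := m%:R; have : 0 <= k by exact: ler0n.
    set u := r^-1; move=> k0; have : 0 <= (u - 1) * (u - 1) * k.
      by rewrite mulr_ge0 // -expr2 sqr_ge0.
    lra.
  by apply: le_trans h1 _; rewrite ler_pM2l ?invr_gt0.
rewrite -ltf_pV2 ?posrE ?exprn_gt0 // -exprVn.
by have := bern n; lra.
Qed.

(* With v = 1 - u the equation v^2 = 1 - x becomes u = (x + u^2) / 2, and the
   right-hand side is a contraction on the ball of radius ||x||. *)
Lemma sqrt_one_sub x : star x = x -> cnorm x < 1 ->
  exists v : T, [/\ star v = v, v * v = 1 - x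
    & forall z, GRing.comm z x -> GRing.comm z v].
Proof.
move=> xs x1.
pose f u : T := (2^-1 : R)%:C *: (x + u * u).
pose u n := iter n f 0.
have h2 : 0 <= (2^-1 : R) by rewrite invr_ge0.
have ule n : cnorm (u n) <= cnorm x.
  elim: n => [|n ih]; first by rewrite /= cnorm0 cnorm_ge0.
  rewrite /= /f cnormZr //.
  have := cnormD x (u n * u n); have := cnormM (u n) (u n).
  have : cnorm (u n) * cnorm (u n) <= cnorm x * 1.
    by rewrite ler_pM ?cnorm_ge0 // (le_trans ih) // ltW.
  lra.
have fcontr a b : cnorm a <= cnorm x -> cnorm b <= cnorm x ->
    cnorm (f a - f b) <= cnorm x * cnorm (a - b).
  move=> ha hb.
  have -> : f a - f b = (2^-1 : R)%:C *: (a * (a - b) + (a - b) * b).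
    rewrite /f -scalerBr opprD addrACA subrr add0r mulrBr mulrBl addrA.
    by rewrite subrK.
  rewrite cnormZr //.
  have := cnormD (a * (a - b)) ((a - b) * b).
  have := cnormM a (a - b); have := cnormM (a - b) b.
  have := ler_wpM2r (cnorm_ge0 (a - b)) ha.
  have := ler_wpM2l (cnorm_ge0 (a - b)) hb.
  lra.
(* The contraction, started at 0, makes the iterates Cauchy at a geometric rate. *)
have udist n k : cnorm (u (n + k)%N - u n) <= cnorm x ^+ n.
  elim: n => [|n ih]; first by rewrite subr0 expr0 (le_trans (ule _)) // ltW.
  rewrite addSn /= (le_trans (fcontr _ _ _ _)) ?ule // exprS.
  by rewrite ler_wpM2l ?cnorm_ge0.
have geo e := @geometric_lt (cnorm x) e (introT andP (conj (cnorm_ge0 x) x1)).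
have [|l ul] := @cnorm_complete R T u.
  move=> e e0; have [N hN] := geo _ e0; exists N => m n Nm Nn.
  wlog mn : m n Nm Nn / (n <= m)%N => [hw|].
    by case: (leqP n m) => [/hw->//|/ltnW/hw]; rewrite -cnormN opprB => ->.
  by rewrite -(subnKC mn) (le_lt_trans (udist _ _)) // hN.
(* Each identity for the limit l is obtained by bounding its defect by a multiple of the distances
   from two consecutive iterates to l. *)
have lim0 (X : T) c : 0 <= c ->
    (forall n, cnorm X <= c * (cnorm (u n - l) + cnorm (u n.+1 - l))) -> X = 0.
  move=> c0 hX; apply: cnorm_eq0P => e e0.
  have c2 : 0 < 2 * (c + 1) by rewrite mulr_gt0 // ltr_wpDl.
  have e' : 0 < e / (2 * (c + 1)) by rewrite divr_gt0.
  have [N hN] := ul _ e'.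
  have := hX N; have := hN N (leqnn _); have := hN N.+1 (leqnSn _).
  have : e = 2 * (c + 1) * (e / (2 * (c + 1))) by rewrite mulrC divfK // gt_eqF.
  set A := cnorm (u N - l); set B := cnorm (u N.+1 - l).
  move: e'; set d := e / _ => e' hd hB hA.
  have : c * (A + B) <= c * (d + d) by rewrite ler_wpM2l // ltW // ltrD.
  lra.
have us n : star (u n) = u n.
  by elim: n => [|n ih]; rewrite /= ?star0 // /f starZr starD starM xs ih.
have ls : star l = l.
  apply/eqP; rewrite -subr_eq0; apply/eqP; apply: (lim0 _ 2) => // n.
  have := cnormD (star (l - u n)) (u n - l).
  have -> : star (l - u n) + (u n - l) = star l - l.
    by rewrite starB us addrA subrK.
  rewrite cnorm_star -(cnormN (l - _)) opprB.
  by have := cnorm_ge0 (u n.+1 - l); lra.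
have lle : cnorm l <= cnorm x.
  apply/ler_addgt0Pl => e e0; have [N hN] := ul _ e0.
  have := cnormD (u N) (l - u N); rewrite addrC subrK -(cnormN (_ - u N)) opprB.
  by have := hN N (leqnn _); have := ule N; lra.
have fl : f l = l.
  apply/eqP; rewrite -subr_eq0; apply/eqP; apply: (lim0 _ 1) => // n.
  have := cnormD (f l - u n.+1) (u n.+1 - l); rewrite addrA subrK.
  have := fcontr l (u n) lle (ule n); rewrite -(cnormN (l - _)) opprB.
  have := ler_wpM2r (cnorm_ge0 (u n - l)) (ltW x1).
  rewrite -/(u n.+1); lra.
exists (1 - l); split.
- by rewrite starB star1 ls.
- have : l + l = x + l * l.
    rewrite -{1 2}fl /f -scalerDl -rmorphD.
    have -> : 2^-1 + 2^-1 = 1 :> R by lra.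
    by rewrite scale1r.
  move=> h; rewrite mulrBl mul1r mulrBr mulr1 opprB addrACA -opprD h opprD.
  by rewrite addrACA subrr addr0.
- move=> z zx; apply: commrB; first exact: commr1.
  have zu n : GRing.comm z (u n).
    elim: n => [|n ih]; first exact: commr0.
    by rewrite /= /f /GRing.comm -scalerAr -scalerAl; congr (_ *: _);
      apply: commrD => //; apply: commrM.
  apply/eqP; rewrite -subr_eq0; apply/eqP.
  apply: (lim0 _ (2 * cnorm z)) => [|n]; first by rewrite mulr_ge0 ?cnorm_ge0.
  have -> : z * l - l * z = (u n - l) * z - z * (u n - l).
    by rewrite mulrBl mulrBr (zu n) opprB [RHS]addrC addrA subrK.
  have := cnormD ((u n - l) * z) (- (z * (u n - l))); rewrite cnormN.
  have := cnormM (u n - l) z; have := cnormM z (u n - l).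
  have := mulr_ge0 (cnorm_ge0 z) (cnorm_ge0 (u n.+1 - l)).
  lra.
Qed.
End CStar.

(** * Positivity expressed through the norm, and the existence of a state *)

Section NormPositive.
Context {R : realType} {T : cstarAlgType R}.
Implicit Types (x y z a b w : T) (r t e : R).

(* For self-adjoint x this says that the spectrum of x is nonnegative. *)
Definition npos x : Prop :=
  exists t : R, 0 <= t /\ cnorm (t%:C *: 1 - x) <= t.

Lemma mulC_ii : 'i%C * 'i%C = -1 :> R[i].
Proof. by rewrite -expr2 sqr_i. Qed.

Lemma nposD x y : npos x -> npos y -> npos (x + y).
Proof.
move=> [t [t0 tx]] [s [s0 sy]]; exists (t + s); split; first exact: addr_ge0.
rewrite rmorphD scalerDl opprD addrACA.
by apply: le_trans (cnormD _ _) _; exact: lerD.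
Qed.

Lemma nposZ r x : 0 <= r -> npos x -> npos (r%:C *: x).
Proof.
move=> r0 [t [t0 tx]]; exists (r * t); split; first exact: mulr_ge0.
by rewrite rmorphM -scalerA -scalerBr cnormZr // ler_wpM2l.
Qed.

(** As a and b commute, z = a + ib satisfies z* z = a^2 + b^2; and a is the real part of z, so ||a||
    <= ||z||. *)
Lemma cnorm_sqr_leD a b : star a = a -> star b = b -> GRing.comm a b ->
  cnorm (a * a) <= cnorm (a * a + b * b).
Proof.
move=> sa sb ab; pose z := a + 'i%C *: b.
have sz : star z = a - 'i%C *: b.
  by rewrite starD starZ_conjc sa sb -scaleNr; congr (_ + _ *: _); simpc.
have zz : star z * z = a * a + b * b.
  rewrite sz mulrBl !mulrDr -!scalerAl -!scalerAr scalerA -ab.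
  rewrite mulC_ii scaleN1r opprD opprK addrA.
  by congr (_ + _); rewrite addrK.
have za : (2 : R)%:C *: a = z + star z.
  rewrite sz addrACA subrr addr0 -[(2 : R)]/(1 + 1) rmorphD scalerDl.
  by rewrite !scale1r.
have := cnormD z (star z); rewrite -za cnorm_star cnormZr // => h.
rewrite cnorm_sqr // -zz cnorm_starM ler_pXn2r ?nnegrE ?cnorm_ge0 //.
lra.
Qed.

(** After rescaling a to b of norm below 1, a root v of 1 - b^2 commutes with b, and ||1 - b^2|| =
    ||v^2|| <= ||v^2 + b^2|| = 1. *)
Lemma npos_sqr a : star a = a -> npos (a * a).
Proof.
move=> sa; pose k := (cnorm a + 1)^-1; pose b := k%:C *: a.
have k1 : 0 < cnorm a + 1 by rewrite ltr_wpDl ?cnorm_ge0.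
have k0 : 0 < k by rewrite invr_gt0.
have sb : star b = b by rewrite starZr sa.
have b1 : cnorm b < 1.
  by rewrite cnormZr ?ltW // ltr_pdivrMl // mulr1; lra.
have bb1 : cnorm (b * b) < 1.
  rewrite cnorm_sqr // expr2 -[ltRHS]mulr1.
  by rewrite ltr_pM ?cnorm_ge0.
have [|v [sv vv vc]] := sqrt_one_sub _ bb1; first by rewrite starM sb.
have bv : GRing.comm b v by apply: vc; rewrite /GRing.comm mulrA.
have nb : npos (b * b).
  exists 1; split=> //; rewrite scale1r -vv.
  have := cnorm_sqr_leD sv sb (commr_sym bv).
  by rewrite vv subrK cnorm1.
have -> : a * a = ((k^-1) * (k^-1))%:C *: (b * b).
  rewrite -scalerAl -scalerAr !scalerA -!rmorphM.
  by rewrite divfK ?gt_eqF // mulVf ?gt_eqF // scale1r.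
by apply: nposZ => //; rewrite mulr_ge0 // invr_ge0 ltW.
Qed.

(** Here w + e = (t + e)(1 - x) with ||x|| <= t/(t + e) < 1; the shift by e makes the last bound
    strict, as [sqrt_one_sub] requires. *)
Lemma npos_sqrt w e : star w = w -> npos w -> 0 < e ->
  exists v : T, [/\ star v = v, v * v = w + e%:C *: 1
    & forall z, GRing.comm z w -> GRing.comm z v].
Proof.
move=> sw [t [t0 tw]] e0; have te : 0 < t + e by rewrite ltr_wpDl.
pose x := (t + e)^-1%:C *: (t%:C *: 1 - w).
have x1 : cnorm x < 1.
  by rewrite cnormZr ?invr_ge0 ?ltW // ltr_pdivrMl // mulr1; lra.
have [|v [sv vv vc]] := sqrt_one_sub _ x1.
  by rewrite starZr starB starZr star1 sw.
exists ((Num.sqrt (t + e))%:C *: v); split.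
- by rewrite starZr sv.
- rewrite -scalerAl -scalerAr scalerA -rmorphM -expr2 sqr_sqrtr ?ltW // vv.
  rewrite scalerBr scalerA -rmorphM divff ?gt_eqF // scale1r rmorphD scalerDl.
  by rewrite opprB addrC addrA subrK addrC.
- move=> z zw; rewrite /GRing.comm -scalerAr -scalerAl; congr (_ *: _).
  apply: vc; rewrite /GRing.comm -scalerAr -scalerAl; congr (_ *: _).
  apply: commrB => //; rewrite /GRing.comm -scalerAr -scalerAl.
  by rewrite mulr1 mul1r.
Qed.

(** Replace w by w + e, the square of an element commuting with a, and let e tend to 0. *)
Lemma cnorm_sqr_leD_npos a w : star a = a -> star w = w -> GRing.comm a w ->
  npos w -> cnorm (a * a) <= cnorm (a * a + w).
Proof.
move=> sa sw aw nw; apply/ler_addgt0Pl => e e0.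
have [v [sv vv vc]] := npos_sqrt sw nw e0.
have := cnorm_sqr_leD sa sv (vc _ aw); rewrite vv addrA => h.
apply: le_trans h _; have := cnormD (a * a + w) (e%:C *: 1).
by rewrite cnormZr ?(ltW e0) // cnorm1 mulr1; lra.
Qed.

(** With the self-adjoint a = z + z* and b = iz - iz*, the sum is half of a^2 + b^2. *)
Lemma npos_starMD z : npos (star z * z + z * star z).
Proof.
pose a := z + star z; pose b := 'i%C *: (z - star z).
have sa : star a = a by rewrite starD starK addrC.
have sb : star b = b.
  by rewrite starZ_conjc starB starK -opprB scalerN -scaleNr; congr (_ *: _);
    simpc.
have -> : star z * z + z * star z = (2^-1 : R)%:C *: (a * a + b * b).
  rewrite /b -scalerAl -scalerAr scalerA mulC_ii scaleN1r.
  rewrite mulrBl !mulrBr /a mulrDl !mulrDr.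
  set A := z * z; set B := z * star z; set C := star z * z; set D := star z * _.
  have -> : A + B + (C + D) - (A - B - (C - D)) = (B + C) + (B + C).
    rewrite opprB opprB [(C - D) + _]addrC addrACA [A + B]addrC.
    rewrite [B + A + _]addrACA subrr addr0 [C + D + _]addrACA subrr addr0.
    by rewrite addrACA.
  rewrite [C + B]addrC -[X in _ *: (X + _)]scale1r -[X in _ *: (_ + X)]scale1r.
  rewrite -scalerDl scalerA -(rmorph1 (real_complex R)) -!rmorphD -rmorphM.
  by rewrite -[1 + 1]/(2 : R) mulVf // scale1r.
by apply: nposZ; [rewrite invr_ge0 | apply: nposD; exact: npos_sqr].
Qed.

(* Step of the sum-of-squares certificate for t^(k+1) - t^k + 1, t = q^2:
   the k-th and (k+1)-st polynomials differ by t^k (t - 1)^2. *)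
Lemma npos_power_gap q k : star q = q ->
  npos ((q * q) ^+ k.+1 - (q * q) ^+ k + 1).
Proof.
move=> sq; elim: k => [|k ih].
  by rewrite expr1 expr0 subrK; exact: npos_sqr.
set t := q * q.
have qt : GRing.comm q t by rewrite /GRing.comm mulrA.
have -> : t ^+ k.+2 - t ^+ k.+1 + 1 =
    t ^+ k.+1 - t ^+ k + 1 + (q ^+ k * (t - 1)) * (q ^+ k * (t - 1)).
  have cq : GRing.comm (t - 1) (q ^+ k).
    apply: commrX; apply: commr_sym; apply: commrB => //; exact: commr1.
  rewrite -[_ * _ * (q ^+ k * _)]mulrA (mulrA (t - 1)) cq -mulrA mulrA.
  rewrite -exprMn_comm // -/t mulrA !mulrBr !mulr1 mulrBl -!exprSr.
  by rewrite [RHS]addrC addrA subrK.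
rewrite -/t in ih; apply: nposD => //; apply: npos_sqr.
rewrite starM starB star1 starM starX sq -/t.
apply: commrX; apply: commr_sym; apply: commrB => //; exact: commr1.
Qed.

Lemma npos_starM_lt1 y : cnorm y < 1 -> npos (star y * y).
Proof.
move=> y1.
pose s := 1 - star y * y; pose p := 1 - y * star y.
have y1' : cnorm y ^+ 2 < 1 by rewrite expr_lt1 ?cnorm_ge0.
have h1 : cnorm (star y * y) < 1 by rewrite cnorm_starM.
have c1 : cnorm (y * star y) < 1.
  by rewrite -{1}[y]starK cnorm_starM cnorm_star.
have [|v [sv vv _]] := sqrt_one_sub _ h1; first by rewrite starM starK.
have [|q [sq qq _]] := sqrt_one_sub _ c1; first by rewrite starM starK.
rewrite -/s in vv; rewrite -/p in qq.
have ss : star s = s by rewrite -vv starM sv.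
(* Intertwining: y s = y - y y* y = p y. *)
have ysX n : y * s ^+ n = p ^+ n * y.
  elim: n => [|n ih]; first by rewrite !expr0 mulr1 mul1r.
  rewrite exprSr mulrA ih -mulrA exprSr -[RHS]mulrA; congr (_ * _).
  by rewrite mulrBr mulrBl mulr1 mul1r mulrA.
have key n : cnorm s ^+ (n + n).+1 <= 1 + cnorm s ^+ (n + n).
  pose z := y * s ^+ n; pose m := (n + n)%N.
  have sz : star z = s ^+ n * star y by rewrite starM starX ss.
  have zz : star z * z = s ^+ m - s ^+ m.+1.
    rewrite sz -mulrA (mulrA (star y)).
    have -> : star y * y = 1 - s by rewrite opprB addrC subrK.
    by rewrite mulrBl mul1r mulrBr -exprS -!exprD addnS.
  have zz' : z * star z = p ^+ m - p ^+ m.+1.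
    rewrite sz /z -mulrA (mulrA (s ^+ n)) -exprD mulrA ysX -mulrA.
    have -> : y * star y = 1 - p by rewrite opprB addrC subrK.
    by rewrite mulrBr mulr1 -exprSr.
  pose w := s ^+ m - s ^+ m.+1 + 1.
  (* w is the sum of z* z + z z* and p^(m+1) - p^m + 1, both positive; the powers of p cancel. *)
  have nw : npos w.
    have := nposD (npos_starMD z) (npos_power_gap m sq).
    by rewrite zz zz' qq addrA -[_ - p ^+ m.+1]opprB addrNK.
  (* Since m = 2n is even, s^(m+1) is the square of the self-adjoint s^n v. *)
  have sm : s ^+ m.+1 = (s ^+ n * v) * (s ^+ n * v).
    have cv : GRing.comm v (s ^+ n).
      by apply: commrX; rewrite -vv /GRing.comm mulrA.
    by rewrite -mulrA (mulrA v) cv -mulrA vv mulrA -exprD exprSr.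
  have sa : star (s ^+ n * v) = s ^+ n * v.
    rewrite starM starX sv ss.
    by apply: commrX; rewrite -vv /GRing.comm mulrA.
  have sw : star w = w by rewrite starD starB !starX ss star1.
  have cw : GRing.comm (s ^+ n * v) w.
    have cs k : GRing.comm (s ^+ n * v) (s ^+ k).
      apply: commrX; apply: commr_sym; apply: commrM.
        by apply: commrX.
      by rewrite -vv /GRing.comm mulrA.
    by apply: commrD; [apply: commrB | exact: commr1].
  have := cnorm_sqr_leD_npos sa sw cw nw.
  have -> : s ^+ n * v * (s ^+ n * v) + w = 1 + s ^+ m.
    by rewrite -sm /w addrC addrAC subrK addrC.
  rewrite -sm cnormX // => h; apply: le_trans h _.
  by apply: le_trans (cnormD _ _) _; rewrite cnorm1 lerD2l cnormX_le.
(* If ||s|| > 1, dividing [key] by ||s||^(2N) leaves ||s|| - 1 <= ||s||^(-2N), which fails for large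
   N. *)
exists 1; split=> //; rewrite scale1r -/s leNgt; apply/negP => M1.
have M0 : 0 < cnorm s by exact: lt_trans M1.
have [||N hN] := @geometric_lt R (cnorm s)^-1 (cnorm s - 1).
- by rewrite invr_ge0 ltW //= invf_lt1.
- by rewrite subr_gt0.
have := hN (N + N)%N (leq_addr _ _).
apply/negP; rewrite -leNgt exprVn lerBlDr -(ler_pM2r (exprn_gt0 (N + N) M0)).
by rewrite -exprS mulrDl mul1r mulVf ?gt_eqF ?exprn_gt0 // key.
Qed.

Lemma npos_starM y : npos (star y * y).
Proof.
pose k := cnorm y + 1.
have k0 : 0 < k by rewrite ltr_wpDl ?cnorm_ge0.
have -> : star y * y = (k * k)%:C *:
    (star (k^-1%:C *: y) * (k^-1%:C *: y)).
  rewrite starZr -scalerAl -scalerAr !scalerA -!rmorphM.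
  by rewrite mulfK ?mulfV ?gt_eqF // scale1r.
apply: nposZ; first by rewrite mulr_ge0 // ltW.
apply: npos_starM_lt1.
by rewrite cnormZr ?invr_ge0 ?ltW // ltr_pdivrMl // mulr1 /k; lra.
Qed.

Definition sa_part x : T := (2^-1 : R)%:C *: (x + star x).

Lemma sa_partD x y : sa_part (x + y) = sa_part x + sa_part y.
Proof. by rewrite /sa_part starD addrACA scalerDr. Qed.

Lemma sa_partZr r x : sa_part (r%:C *: x) = r%:C *: sa_part x.
Proof. by rewrite /sa_part starZr -scalerDr !scalerA mulrC. Qed.

Lemma sa_partN x : sa_part (- x) = - sa_part x.
Proof. by rewrite /sa_part starN -opprD scalerN. Qed.

Lemma sa_part_id x : star x = x -> sa_part x = x.
Proof.
move=> sx; rewrite /sa_part sx -[X in _ *: (X + _)]scale1r.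
rewrite -[X in _ *: (_ + X)]scale1r -scalerDl scalerA.
rewrite -(rmorph1 (real_complex R)) -!rmorphD -rmorphM.
by rewrite -[1 + 1]/(2 : R) mulVf // scale1r.
Qed.

Lemma state_exists : inhabited (state T 1).
Proof.
(* The constraints a <= g(a 1) for a >= 0, together with g <= [cnorm], force g 1 = 1. *)
pose W (w : T) (a : R) := 0 <= a /\ w = a%:C *: 1.
have [||w a [a0 ->]|g [[gD gZ] g_le gW]] := @mazur_orlicz R T (@cnorm R T) W.
- split=> [x y|r x r0]; first exact: cnormD.
  by rewrite cnormZr // ltW.
- split=> [|v w a b [a0 ->] [b0 ->]|r w a r0 [a0 ->]].
  + by split=> //; rewrite scale0r.
  + by split; rewrite ?addr_ge0 // rmorphD scalerDl.
  + by split; [rewrite mulr_ge0 // ltW | rewrite rmorphM scalerA].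
- by rewrite cnormZr // cnorm1 mulr1.
have gN x : g (- x) = - g x.
  by rewrite -scaleN1r -(rmorphN1 (real_complex R)) gZ mulN1r.
have g1 : g 1 = 1.
  have := g_le 1; rewrite cnorm1 => g1le; apply/eqP; rewrite eq_le g1le gW //.
  by split; rewrite ?scale1r.
(* t - g x = g(t 1 - x) <= ||t 1 - x|| <= t. *)
have g_pos x : npos x -> 0 <= g x.
  move=> [t [t0 tx]]; have := le_trans (g_le _) tx.
  by rewrite gD gN gZ g1; lra.
(* The two arguments of g are the real and imaginary parts of x, so F is complex linear and agrees
   with g on self-adjoint elements. *)
pose F x := (g (sa_part x) +i* g (sa_part (- 'i%C *: x)))%C.
have FD x y : F (x + y) = F x + F y.
  by rewrite /F scalerDr !sa_partD !gD.
have FZr r x : F (r%:C *: x) = r%:C * F x.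
  rewrite /F scalerA mulrC -scalerA !sa_partZr !gZ; simpc.
  by [].
have sa_part_i x : sa_part ('i%C *: x) = - sa_part (- 'i%C *: x).
  by rewrite scaleNr sa_partN opprK.
have Fi x : F ('i%C *: x) = 'i%C * F x.
  rewrite /F scalerA mulNr mulC_ii opprK scale1r sa_part_i gN.
  by set u := g _; set v := g _; simpc.
have FZ c x : F (c *: x) = c * F x.
  by rewrite [c]complexE scalerDl FD FZr -scalerA Fi FZr mulrDl mulrA.
have sa_im x : star x = x -> sa_part (- 'i%C *: x) = 0.
  move=> sx; rewrite /sa_part starZ_conjc sx -scalerDl.
  suff -> : - 'i%C + (- 'i%C)^*%C = 0 :> R[i] by rewrite scale0r scaler0.
  by simpc; rewrite ?addrN ?addNr.
have g0 : g 0 = 0 by rewrite -(scale0r 0) (gZ 0) mul0r.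
have Fsa x : star x = x -> F x = (g x)%:C.
  by move=> sx; rewrite /F sa_part_id // sa_im // g0.
have D (X Y : 'M[T]_1) : F ((X + Y) 0 0) = F (X 0 0) + F (Y 0 0).
  by rewrite mxE FD.
have Z c (X : 'M[T]_1) : F (map_mx ( *:%R c) X 0 0) = c * F (X 0 0).
  by rewrite mxE FZ.
have P (X : 'M[T]_1) : pos_mx X -> 0 <= F (X 0 0).
  move=> [Y ->]; rewrite mxE big_ord1 !mxE Fsa; last by rewrite starM starK.
  by rewrite ler0c g_pos //; exact: npos_starM.
have U : F ((1%:M : 'M[T]_1) 0 0) = 1.
  by rewrite mxE Fsa ?star1 // g1.
exact: inhabits (State D Z P U).
Qed.

End NormPositive.

(** * C*-convex hulls and matrix tests *)

Section SpanCP.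
Context {R : realType} {A : cstarAlgType R}.
Variables (S : operatorSystem A) (T : cstarAlgType R).
Implicit Types (Phi Psi : opsys S -> T) (K : set (opsys S -> T)).

Lemma CP_conj (a : T) Phi :
  CP S T Phi -> CP S T (fun x => star a * Phi x * a).
Proof.
move=> [lin pos]; split.
  by move=> c x y; rewrite lin mulrDr mulrDl -scalerAr -scalerAl.
move=> k X k0 /(pos k X k0) [Y XY]; exists (map_mx ( *%R^~ a) Y).
apply/matrixP => i j; move/matrixP: XY => /(_ i j); rewrite !mxE => ->.
rewrite mulr_sumr mulr_suml; apply: eq_bigr => l _.
by rewrite !mxE starM !mulrA.
Qed.

Lemma spanCP_conj (a : T) Phi : Phi \in @spanCP R A S T ->
  (fun x => star a * Phi x * a) \in @spanCP R A S T.
Proof.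
move=> /asboolP[n [c [w [CPw ->]]]]; apply/asboolP.
exists n, c, (fun i x => star a * w i x * a); split=> [i|].
  exact: CP_conj.
apply/funext => x; rewrite !fct_sumE mulr_sumr mulr_suml; apply: eq_bigr => i _.
have -> : (c i *: w i) x = c i *: w i x by [].
by rewrite -scalerAr -scalerAl.
Qed.

Lemma spanCP_linear Phi : Phi \in @spanCP R A S T -> linear Phi.
Proof.
move=> /asboolP[n [c [w [CPw ->]]]] d x y.
rewrite !fct_sumE scaler_sumr -big_split /=; apply: eq_bigr => i _.
have [lin _] := CPw i.
have scalew z : (c i *: w i) z = c i *: w i z by [].
by rewrite !scalew lin scalerDr !scalerA mulrC.
Qed.

(** Makes the span a competitor in the intersection defining [cconv], so that hulls of sets of CP
    maps lie in the space carrying the topology. *)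
Lemma cstar_convex_spanCP : cstar_convex [set Phi | Phi \in @spanCP R A S T].
Proof.
move=> n a Phi n0 PhiP _ /=.
have -> : (fun x => \sum_(i < n) star (a i) * Phi i x * a i) =
    \sum_(i < n) (fun x => star (a i) * Phi i x * a i).
  by apply/funext => x; rewrite fct_sumE.
apply: rpred_sum => i _; apply: (@spanCP_conj (a i) (Phi i)).
exact: (PhiP i).
Qed.

Lemma cconv_spanCP K : K `<=` CP S T ->
  forall Phi, cconv K Phi -> Phi \in @spanCP R A S T.
Proof.
move=> KCP Phi h; apply: (h [set Psi | Psi \in @spanCP R A S T]).
by split; [exact: cstar_convex_spanCP | move=> Psi /KCP; exact: CP_spanCP].
Qed.

Lemma cstar_convex_cconv K : cstar_convex (cconv K).
Proof.
move=> n a Phi n0 PhiK sa M [cM KM].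
by apply: (cM n a Phi) => // i; exact: (PhiK i M (conj cM KM)).
Qed.

(** The scalar coefficients sqrt(t) 1 and sqrt(1 - t) 1 turn a C*-convex combination into an
    ordinary one. *)
Lemma cconv_convex K Phi Psi (t : R) : cconv K Phi -> cconv K Psi ->
  0 <= t <= 1 -> cconv K (fun x => t%:C *: Phi x + (1 - t)%:C *: Psi x).
Proof.
move=> KPhi KPsi /andP[t0 t1].
pose a (i : 'I_2) : T :=
  (Num.sqrt (if i == 0 then t else 1 - t))%:C *: 1.
have aa (i : 'I_2) x :
    star (a i) * x * a i = (if i == 0 then t else 1 - t)%:C *: x.
  rewrite starZr star1 -!scalerAl -scalerAr mulr1 mul1r scalerA -rmorphM.
  by rewrite -expr2 sqr_sqrtr //; case: ifP; rewrite ?subr_ge0.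
have := @cstar_convex_cconv K 2 a (fun i => if i == 0 then Phi else Psi).
move=> /(_ isT) h.
have -> : (fun x => t%:C *: Phi x + (1 - t)%:C *: Psi x) =
    (fun x => \sum_(i < 2) star (a i) * (if i == 0 then Phi else Psi) x * a i).
  by apply/funext => x; rewrite !big_ord_recl big_ord0 !aa addr0.
apply: h => [i|]; first by case: ifP.
have aa1 i : star (a i) * a i = (if i == 0 then t else 1 - t)%:C *: 1.
  by rewrite -aa mulr1.
by rewrite !big_ord_recl big_ord0 !aa1 addr0 -scalerDl -rmorphD addrC subrK
  scale1r.
Qed.

End SpanCP.

(** * Linear combinations of matrix tests *)

Section Tests.
Context {R : realType} {A : cstarAlgType R}.
Variables (S : operatorSystem A) (T : cstarAlgType R).
Implicit Types (Phi Psi : opsys S -> T) (t : matrixTest S T) (c : R[i]).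

Lemma state0 k (f : state T k) : f 0 = 0.
Proof. by apply: (addrI (f 0)); rewrite -stateD !addr0. Qed.

Lemma test_valD t Phi Psi :
  test_val t (fun x => Phi x + Psi x) = test_val t Phi + test_val t Psi.
Proof.
by rewrite /test_val -stateD; congr (_ _); apply/matrixP => i j; rewrite !mxE.
Qed.

Lemma test_valZ t c Phi :
  test_val t (fun x => c *: Phi x) = c * test_val t Phi.
Proof.
by rewrite /test_val -stateZ; congr (_ _); apply/matrixP => i j; rewrite !mxE.
Qed.

Lemma test_valB t Phi Psi :
  test_val t (Phi - Psi) = test_val t Phi - test_val t Psi.
Proof.
have -> : Phi - Psi = (fun x => Phi x + -1 *: Psi x).
  by apply/funext => x; rewrite scaleN1r.
by rewrite test_valD test_valZ mulN1r.
Qed.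

(* The sum of squares is split row by row: each row is padded with zeros to a
   square matrix, so positivity of f needs no C*-structure on matrices. *)
Lemma state_star_mulmx_ge0 k (f : state T k) m (Z : 'M[T]_(m, k)) :
  (0 < k)%N -> 0 <= f (star_mx Z *m Z).
Proof.
case: k f Z => // k f Z _.
have -> : star_mx Z *m Z = \sum_l (star_mx (row l Z) *m row l Z).
  apply/matrixP => i j; rewrite summxE !mxE; apply: eq_bigr => l _.
  by rewrite !mxE big_ord1 !mxE.
rewrite (big_morph f (@stateD _ _ _ f) (state0 f)); apply: sumr_ge0 => l _.
apply: state_ge0; exists (\matrix_(i, j) if i == 0 then Z l j else 0).
apply/matrixP => i j; rewrite !mxE big_ord1 big_ord_recl big1 ?addr0 ?mxE //.
by move=> p _; rewrite !mxE /= mulr0.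
Qed.

(** A diagonal corner of Y* Y is Z* Z with Z a block of columns of Y; this is why
    [state_star_mulmx_ge0] admits rectangular Z. *)
Lemma state_block k1 k2 (f1 : state T k1) (f2 : state T k2) :
  (0 < k1)%N -> (0 < k2)%N ->
  exists f : state T (k1 + k2)%N,
    forall X, f X = 2^-1 * (f1 (ulsubmx X) + f2 (drsubmx X)).
Proof.
move=> k1_gt0 k2_gt0.
pose F (X : 'M[T]_(k1 + k2)) := 2^-1 * (f1 (ulsubmx X) + f2 (drsubmx X)).
have FD X Y : F (X + Y) = F X + F Y.
  rewrite /F -mulrDr; congr (_ * _); rewrite addrACA -!stateD.
  by congr (f1 _ + f2 _); apply/matrixP => i j; rewrite !mxE.
have FZ c X : F (map_mx ( *:%R c) X) = c * F X.
  by rewrite /F -map_ulsubmx -map_drsubmx !stateZ -mulrDr mulrCA.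
have FP X : pos_mx X -> 0 <= F X.
  move=> [Y ->]; rewrite /F mulr_ge0 ?invr_ge0 //; apply: addr_ge0.
    suff -> : ulsubmx (star_mx Y *m Y) = star_mx (lsubmx Y) *m lsubmx Y.
      exact: state_star_mulmx_ge0.
    by apply/matrixP => i j; rewrite !mxE; apply: eq_bigr => l _; rewrite !mxE.
  suff -> : drsubmx (star_mx Y *m Y) = star_mx (rsubmx Y) *m rsubmx Y.
    exact: state_star_mulmx_ge0.
  by apply/matrixP => i j; rewrite !mxE; apply: eq_bigr => l _; rewrite !mxE.
have F1 : F 1%:M = 1.
  rewrite /F (_ : ulsubmx _ = 1%:M); last first.
    by apply/matrixP => i j; rewrite !mxE (inj_eq (@lshift_inj _ _)).
  rewrite (_ : drsubmx _ = 1%:M); last first.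
    by apply/matrixP => i j; rewrite !mxE (inj_eq (@rshift_inj _ _)).
  by rewrite !state1 mulVf // (@pnatr_eq0 _ 2).
by exists (State FD FZ FP F1).
Qed.

Lemma linear_scale Phi c x : linear Phi -> Phi (c *: x) = c *: Phi x.
Proof.
move=> lin; have P0 : Phi 0 = 0.
  by have := lin (-1) 0 0; rewrite scaler0 addr0 scaleN1r addNr.
by have := lin c x 0; rewrite addr0 P0 addr0.
Qed.

(** The scalar is put into the matrix entries, because multiplying the state by c would spoil its
    normalisation; linearity of Phi brings it out again. *)
Lemma test_scale t c : exists t', forall Phi, linear Phi ->
  test_val t' Phi = c * test_val t Phi.
Proof.
exists (MatrixTest (mt_size_gt0 t) (mt_state t) (map_mx ( *:%R c) (mt_mx t))).
move=> Phi lin; rewrite /test_val /= -stateZ; congr (_ _).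
by apply/matrixP => i j; rewrite !mxE linear_scale.
Qed.

(* The state (f1 + f2) / 2 on the two diagonal blocks, evaluated at the
   block-diagonal matrix with blocks 2 s1 and 2 s2. *)
Lemma test_add t1 t2 : exists t', forall Phi, linear Phi ->
  test_val t' Phi = test_val t1 Phi + test_val t2 Phi.
Proof.
have [f fE] := state_block (mt_state t1) (mt_state t2)
  (mt_size_gt0 t1) (mt_size_gt0 t2).
have k0 : (0 < mt_size t1 + mt_size t2)%N by rewrite addn_gt0 mt_size_gt0.
exists (MatrixTest k0 f (block_mx (map_mx ( *:%R 2) (mt_mx t1)) 0 0
  (map_mx ( *:%R 2) (mt_mx t2)))).
move=> Phi lin; rewrite /test_val /= fE map_block_mx block_mxKul block_mxKdr.
have E k (X : 'M[opsys S]_k) : map_mx Phi (map_mx ( *:%R (2 : R[i])) X) =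
    map_mx ( *:%R (2 : R[i])) (map_mx Phi X).
  by apply/matrixP => i j; rewrite !mxE linear_scale.
by rewrite !E !stateZ -mulrDr mulrA mulVf ?mul1r // (@pnatr_eq0 _ 2).
Qed.

Lemma test_sum (t0 : matrixTest S T) m (c : 'I_m -> R[i])
    (t : 'I_m -> matrixTest S T) :
  exists t', forall Phi, linear Phi ->
    test_val t' Phi = \sum_i c i * test_val (t i) Phi.
Proof.
elim: m c t => [|m ih] c t.
  (* The empty sum still needs a test of value 0: [t0] rescaled by 0. *)
  have [t' t'E] := test_scale t0 0; exists t' => Phi lin.
  by rewrite big_ord0 t'E // mul0r.
have [t1 t1E] := test_scale (t ord0) (c ord0).
have [t2 t2E] := ih (c \o lift ord0) (t \o lift ord0).
have [t' t'E] := test_add t1 t2; exists t' => Phi lin.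
by rewrite big_ord_recl t'E // t1E // t2E.
Qed.

End Tests.

(** * Separation and the topology of seminorms *)

Section Separation.
Context {R : realType} {m : nat}.
Implicit Types (u v w : 'rV[R[i]]_m) (M : set 'rV[R[i]]_m).

(** The l^1 norm on C^m, in which a finite sum of test seminorms becomes a distance between rows of
    test values. *)
Definition norm1 v : R := \sum_j Normc.normc (v 0 j).

Lemma norm1_sublinear : sublinear norm1.
Proof.
split=> [u v|r v r0].
  rewrite /norm1 -big_split /=; apply: ler_sum => j _.
  by rewrite mxE le_normcD.
rewrite /norm1 mulr_sumr; apply: ler_sum => j _.
by rewrite mxE Normc.normcM normc_real // ltW.
Qed.

Lemma norm1Z (r : R) v : 0 <= r -> norm1 (r%:C *: v) = r * norm1 v.
Proof.
move=> r0; rewrite /norm1 mulr_sumr; apply: eq_bigr => j _.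
by rewrite mxE Normc.normcM normc_real.
Qed.

(** g is the real part of the complex linear functional g(v) - i g(iv), whose coordinates are the
    c_j. *)
Lemma real_linear_rV (g : 'rV[R[i]]_m -> R) : real_linear g ->
  exists c : 'I_m -> R[i],
    forall v, g v = complex.Re (\sum_j c j * v 0 j).
Proof.
move=> [gD gZ]; pose e j : 'rV[R[i]]_m := delta_mx 0 j.
exists (fun j => (g (e j) -i* g ('i%C *: e j))%C) => v.
have g0 : g 0 = 0 by rewrite -(scale0r 0) (gZ 0) mul0r.
have gz (z : R[i]) w :
    g (z *: w) = complex.Re z * g w + complex.Im z * g ('i%C *: w).
  by rewrite {1}[z]complexE scalerDl gD gZ ['i%C * _]mulrC -scalerA gZ.
rewrite {1}[v]row_sum_delta (big_morph g gD g0).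
rewrite (raddf_sum (@complex.Re R : Rcomplex R -> R)) /=; apply: eq_bigr => j _.
rewrite gz -/(e j); case: (v 0 j) => a b /=.
by rewrite mulNr opprK !(mulrC (g _)).
Qed.

(** Mazur-Orlicz for [norm1] and the cone generated by the pairs (v0 - v, e) gives g(v0 - v) >= e on
    M; convexity of M makes this cone closed under addition. *)
Lemma separation M v0 (e : R) : M !=set0 ->
  (forall u v (r : R), M u -> M v -> 0 <= r <= 1 ->
    M (r%:C *: u + (1 - r)%:C *: v)) ->
  (forall v, M v -> e <= norm1 (v0 - v)) ->
  exists c : 'I_m -> R[i], forall v, M v ->
    complex.Re (\sum_j c j * v 0 j) + e <= complex.Re (\sum_j c j * v0 0 j).
Proof.
move=> [u0 Mu0] convM Me.
pose W (w : 'rV[R[i]]_m) (a : R) := exists r v,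
  [/\ 0 <= r, M v, w = r%:C *: (v0 - v) & a = r * e].
have [|w a [r [v [r0 Mv -> ->]]]|g [[gD gZ] g_le gW]] :=
  mazur_orlicz (W := W) norm1_sublinear.
- split=> [|w w' a a' [r [v [r0 Mv -> ->]]] [r' [v' [r'0 Mv' -> ->]]]
    |s w a s0 [r [v [r0 Mv -> ->]]]].
  + by exists 0, u0; rewrite scale0r mul0r.
  (* The weights r / (r + r') require a nonzero sum; otherwise both terms are the apex (0, 0). *)
  + have [rr|rr] := eqVneq (r + r') 0.
      have [-> ->] : r = 0 /\ r' = 0 by split; lra.
      by exists 0, u0; rewrite !scale0r !mul0r !addr0.
    have rr0 : 0 < r + r' by rewrite lt_def rr addr_ge0.
    exists (r + r'), ((r / (r + r'))%:C *: v + (1 - r / (r + r'))%:C *: v').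
    split.
    * exact: ltW.
    * apply: convM => //; rewrite divr_ge0 ?(ltW rr0) //=.
      by rewrite ler_pdivrMr // mul1r lerDl.
    * have cr : (r + r') * (r / (r + r')) = r by rewrite mulrC divfK.
      have cr' : (r + r') * (1 - r / (r + r')) = r'.
        by rewrite mulrBr mulr1 cr addrAC subrr add0r.
      rewrite [RHS]scalerBr [in RHS]scalerDr !scalerA -!rmorphM cr cr'.
      by rewrite !scalerBr rmorphD scalerDl opprD addrACA.
    * by rewrite mulrDl.
  + exists (s * r), v; split=> //; first by rewrite mulr_ge0 // ltW.
      by rewrite rmorphM scalerA.
    by rewrite mulrA.
- by rewrite norm1Z // ler_wpM2l // Me.
have [c cE] := real_linear_rV (conj gD gZ).
exists c => v Mv; rewrite -!cE.
have /gW : W (v0 - v) e by exists 1, v; rewrite scale1r mul1r.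
by rewrite gD -scaleN1r -(rmorphN1 (real_complex R)) gZ; lra.
Qed.

End Separation.

(** * Neighbourhoods in the topology generated by the tests *)

Section Topology.
Context {R : realType} {A : cstarAlgType R}.
Variables (S : operatorSystem A) (T : cstarAlgType R).
Implicit Types (Phi Psi : Espace S T) (t : matrixTest S T).

Lemma test_seminorm_ge0 t Phi : 0 <= test_seminorm t Phi.
Proof.
by rewrite /test_seminorm; case: (test_val t Phi) => a b; exact: sqrtr_ge0.
Qed.

Lemma test_seminorm_le t Phi Psi Theta :
  test_seminorm t (Psi - Theta) <=
  test_seminorm t (Psi - Phi) + test_seminorm t (Phi - Theta).
Proof.
rewrite /test_seminorm !test_valB.
apply: le_trans _ (le_normcD _ _); rewrite addrA subrK //.
Qed.

Lemma test_seminorm_nbhs t Phi (e : R) : 0 < e ->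
  nbhs Phi [set Psi | test_seminorm t (Psi - Phi) < e].
Proof.
move=> e0; apply: open_nbhs_nbhs; split.
  exists [set [set Psi | test_seminorm t (Psi - Phi) < e]].
    move=> _ ->; apply: finI_from1; by exists t, Phi, e.
  by rewrite bigcup_set1.
by rewrite /= /test_seminorm test_valB subrr Normc.normc0.
Qed.

Lemma semiballs_seminorms (I : eqType) (b : I -> set (Espace S T)) (s : seq I)
    Phi :
  (forall i, i \in s -> semiballs (b i) /\ b i Phi) ->
  exists (ts : seq (matrixTest S T)) (e : R), 0 < e /\
    forall Psi, \sum_(t <- ts) test_seminorm t (Psi - Phi) < e ->
      forall i, i \in s -> b i Psi.
Proof.
elim: s => [|i s ih] hs; first by exists [::], 1; split.
have [|ts [e [e0 h]]] := ih.
  by move=> j js; apply: hs; rewrite inE js orbT.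
have [[t [Theta [d [d0 bE]]]] bPhi] := hs i (mem_head _ _).
move: bPhi; rewrite bE /= => bPhi.
(* The semiball may be centred at Theta instead of Phi; the triangle inequality leaves this smaller
   radius around Phi. *)
exists (t :: ts), (Num.min e (d - test_seminorm t (Phi - Theta))).
split; first by rewrite lt_min e0 subr_gt0.
move=> Psi; rewrite big_cons lt_min => /andP[h1 h2].
have s0 : 0 <= \sum_(t <- ts) test_seminorm t (Psi - Phi).
  by apply: sumr_ge0 => t' _; exact: test_seminorm_ge0.
have := test_seminorm_ge0 t (Psi - Phi) => t_ge0.
have := test_seminorm_le t Phi Psi Theta => tri j.
rewrite inE => /predU1P[->|js].
  by rewrite bE /=; lra.
by apply: h js; lra.
Qed.

(** A basic open set is a finite intersection of semiballs, and the sum of the seminorms dominates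
    each of them. *)
Lemma nbhs_seminorms Phi (B : set (Espace S T)) : nbhs Phi B ->
  exists (ts : seq (matrixTest S T)) (e : R), 0 < e /\
    forall Psi, \sum_(t <- ts) test_seminorm t (Psi - Phi) < e -> B Psi.
Proof.
rewrite nbhsE => -[U [[D Dsub UE] UPhi] UB].
move: UPhi; rewrite -UE => -[V DV VPhi].
have VB : V `<=` B by move=> Psi VPsi; apply: UB; rewrite -UE; exists V.
have [F Fsub FE] := Dsub V DV.
have [|ts [e [e0 h]]] := @semiballs_seminorms _ id (finmap.enum_fset F) Phi.
  move=> W WF; split; first by have /set_mem := Fsub W WF.
  by move: VPhi; rewrite -FE; apply.
exists ts, e; split=> // Psi /h hPsi; apply: VB; rewrite -FE => W WF.
exact: hPsi.
Qed.

End Topology.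

Lemma Re_le_normc (R : rcfType) (z : R[i]) : complex.Re z <= Normc.normc z.
Proof.
case: z => a b /=; apply: le_trans (ler_norm a) _.
by rewrite -sqrtr_sqr ler_wsqrtr // lerDl sqr_ge0.
Qed.

Theorem theorem4p2 (R : realType) (A T : cstarAlgType R)
    (S : operatorSystem A) (K : set (opsys S -> T)) (hK : K `<=` CP S T)
    (Phi0 : opsys S -> T) (hPhi0 : CP S T Phi0) :
  closure [set Psi : Espace S T | cconv K Psi] (CP_Espace hPhi0) <->
  (forall t : matrixTest S T,
     ((complex.Re (test_val t Phi0))%:E <= support_fun K t)%E).
Proof.
set E0 := CP_Espace hPhi0; split=> [clPhi0 t|supp].
  (* An element of the hull within e for the single seminorm of t suffices, as Re z <= |z|. *)
  apply/lee_addgt0Pr => e e0.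
  have [Psi [KPsi /= dPsi]] := clPhi0 _ (test_seminorm_nbhs t E0 e0).
  apply: (@le_trans _ _ ((complex.Re (test_val t Psi))%:E + e%:E)%E).
    rewrite -EFinD lee_fin.
    move: dPsi; rewrite /test_seminorm test_valB /= => dPsi.
    have := Re_le_normc (test_val t Phi0 - test_val t Psi).
    rewrite -(normcN (_ - test_val t Psi)) opprB.
    rewrite (raddfB (@complex.Re R : Rcomplex R -> R)) /=; lra.
  rewrite leeD2r //; apply: ereal_sup_ubound.
  by exists (Psi : opsys S -> T).
have Klin Psi : cconv K Psi -> linear Psi.
  by move=> /(cconv_spanCP hK)/spanCP_linear.
apply: contrapT => ncl.
have [B [nB KB]] : exists B, nbhs E0 B /\
    forall Psi : Espace S T, cconv K Psi -> ~ B Psi.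
  apply: contrapT => h; apply: ncl => B nB.
  apply: contrapT => h'; apply: h; exists B; split=> // Psi KPsi BPsi.
  by apply: h'; exists Psi.
have [ts [e [e0 hB]]] := nbhs_seminorms nB.
have [f] := @state_exists R T.
(* Any test would do: it shows that the hull is nonempty, its support value being -oo otherwise, and
   serves as default for [nth] and as base for [test_sum]. *)
pose t0 : matrixTest S T := MatrixTest (ltn0Sn 0) f 0.
have [Psi0 KPsi0] : exists Psi, cconv K Psi.
  apply: contrapT => K0; have := supp t0; rewrite /support_fun.
  suff -> : cconv K = set0 by rewrite image_set0 ereal_sup0 leeNy_eq.
  by apply/seteqP; split=> // Psi KPsi; case: K0; exists Psi.
pose t (j : 'I_(size ts)) := nth t0 ts j.
pose ev (Psi : opsys S -> T) : 'rV[R[i]]_(size ts) := \row_j test_val (t j) Psi.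
have [|||c cP] := @separation R _ [set ev Psi | Psi in cconv K] (ev Phi0) e.
- by exists (ev Psi0), Psi0.
- move=> _ _ r [Phi KPhi <-] [Psi KPsi <-] r01.
  exists (fun x => r%:C *: Phi x + (1 - r)%:C *: Psi x).
    exact: cconv_convex.
  by apply/rowP => j; rewrite !mxE test_valD !test_valZ.
(* A row closer than e to that of Phi0 would put Psi in B, which misses the hull. *)
- move=> _ [Psi KPsi <-]; rewrite leNgt; apply/negP => hlt.
  have := KB (EMap (cconv_spanCP hK KPsi)) KPsi; apply; apply: hB.
  rewrite (big_nth t0) big_mkord; apply: le_lt_trans hlt.
  apply: ler_sum => j _.
  by rewrite !mxE /test_seminorm test_valB -normcN opprB.
have [t' t'E] := test_sum t0 c t.
have evE Psi : linear Psi ->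
    complex.Re (\sum_j c j * ev Psi 0 j) = complex.Re (test_val t' Psi).
  by move=> lin; rewrite t'E //; congr complex.Re; apply: eq_bigr => j _;
    rewrite mxE.
have lin0 : linear Phi0 by case: (hPhi0).
(* The test t' realises the separating functional, so its support value is at most its real part at
   Phi0 minus e. *)
have := supp t'; apply/negP; rewrite -ltNge.
apply: (@le_lt_trans _ _ (complex.Re (test_val t' Phi0) - e)%:E).
  apply: ge_ereal_sup => _ [Psi KPsi <-].
  rewrite lee_fin lerBrDr -!evE //; last exact: Klin.
  by apply: cP; exists Psi.
by rewrite lte_fin ltrBlDr ltrDl.
Qed.
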